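(* Let $q\ge1$. A non-empty subset $\tau$ of $\mathcal{N}^3_q$ is a minimal nonface of $\mathbb{S}^3_q$ if and only if $\tau$ is of one of the following forms: (1) (edges) for distinct indices $a,b,c,d$ in $[q]$ (only the indices occurring in a given set being required to exist): $\{3\mathbf e_a,3\mathbf e_b\}$, $\{3\mathbf e_a,\mathbf e_a+2\mathbf e_b\}$, $\{3\mathbf e_a,2\mathbf e_b+\mathbf e_c\}$, $\{3\mathbf e_a,\mathbf e_a+\mathbf e_b+\mathbf e_c\}$, $\{3\mathbf e_a,\mathbf e_b+\mathbf e_c+\mathbf e_d\}$, $\{2\mathbf e_a+\mathbf e_b,2\mathbf e_b+\mathbf e_c\}$, $\{2\mathbf e_a+\mathbf e_b,\mathbf e_b+2\mathbf e_c\}$, $\{2\mathbf e_a+\mathbf e_b,2\mathbf e_c+\mathbf e_d\}$, $\{2\mathbf e_a+\mathbf e_b,\mathbf e_b+\mathbf e_c+\mathbf e_d\}$; (2) (triangles) $\{2\mathbf e_a+\mathbf e_b,\ \mathbf e_a+2\mathbf e_b,\ \mathbf e_c+\mathbf e_d+\mathbf e_e\}$ for distinct $a,b,c,d,e\in[q]$.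
   Context: Let $\mathsf{k}$ be a field, $[q]=\{1,\dots,q\}$, $\mathbf e_i$ the $i$-th standard unit vector of $\mathbb{R}^q$, and $\mathcal{N}^r_q=\{\mathbf a\in\mathbb{N}^q : a_1+\cdots+a_q=r\}$. The $q$-extremal ideal $\mathcal{E}_q$ is the ideal of $\mathsf{k}[x_A : \emptyset\ne A\subseteq[q]]$ generated by $\epsilon_i=\prod_{A\ni i}x_A$, $i\in[q]$. Its power $\mathcal{E}_q^{\,r}$ is minimally generated by the monomials $\epsilon^{\mathbf a}=\epsilon_1^{a_1}\cdots\epsilon_q^{a_q}$, $\mathbf a\in\mathcal{N}^r_q$. Each set $\sigma\subseteq\mathcal{N}^r_q$ is labeled by $\mathbf{m}_\sigma=\mathrm{lcm}(\epsilon^{\mathbf a}:\mathbf a\in\sigma)$. The Scarf complex $\mathbb{S}^r_q$ of $\mathcal{E}_q^{\,r}$ is the simplicial complex on $\mathcal{N}^r_q$ consisting of all $\sigma\subseteq\mathcal{N}^r_q$ with $\mathbf{m}_\sigma\ne\mathbf{m}_\tau$ for every $\tau\subseteq\mathcal{N}^r_q$, $\tau\neq\sigma$. A minimal nonface is a subset of the vertex set that is not a face but all of whose proper subsets are faces. *)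

(* Defs.v *)
From HB Require Import structures.
From mathcomp Require Import all_boot all_order all_algebra finmap.
From mathcomp Require Import mpoly.

Set Implicit Arguments.
Unset Strict Implicit.
Unset Printing Implicit Defensive.

Import GRing.Theory.
Local Open Scope ring_scope.
Local Open Scope fset_scope.

(* Vectors of N^q are multinomials: U_(i) is the i-th unit vector and mdeg
   the sum of the coordinates.  The index set [q] is 'I_q. *)
Definition expvecs (q r : nat) : {fset 'X_{1..q}} :=
  [fset bmnm m | m in [pred m : 'X_{1..q < r.+1} | mdeg m == r]].

Lemma in_expvecs (q r : nat) (a : 'X_{1..q}) :
  (a \in expvecs q r) = (mdeg a == r).
Proof.
apply/imfsetP/idP => [[m /= + ->] // | da].
have lt_a : (mdeg a < r.+1)%N by rewrite (eqP da).
by exists (BMultinom lt_a).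
Qed.

(* The variables x_A are indexed by the nonempty A; mpoly wants ordinal
   indices, hence the rank of A in the enumeration of this finite type. *)
Definition neset (q : nat) := {A : {set 'I_q} | A != set0}.

Definition extremal_ring (k : fieldType) (q : nat) :=
  {mpoly k[#|{: neset q}|]}.

Section Extremal.
Variables (k : fieldType) (q : nat).
Implicit Types (a : 'X_{1..q}) (s : {fset 'X_{1..q}}).

Definition xvar (A : neset q) : extremal_ring k q := 'X_(enum_rank A).

Definition epsilon (i : 'I_q) : extremal_ring k q :=
  \prod_(A : neset q | i \in val A) xvar A.

Definition epsilon_exp a : extremal_ring k q :=
  \prod_(i < q) epsilon i ^+ a i.

(* Every epsilon_exp a is a monomial, so mlead is its exponent vector; that
   label s is the least common multiple is label_lcmP below. *)
Definition label s : extremal_ring k q :=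
  'X_[\big[@mlcm _/0%MM]_(a <- s) mlead (epsilon_exp a)].

(* The epsilon_exp a, a \in expvecs q r, are the minimal generators of the r-th
   power of the ideal (epsilon i | i : 'I_q); it is through them that the ideal
   enters its Scarf complex. *)
Definition scarf (r : nat) s : Prop :=
  s `<=` expvecs q r /\
  forall t, t `<=` expvecs q r -> t <> s -> label s <> label t.

Lemma epsilon_exp_monomial a : epsilon_exp a = 'X_[mlead (epsilon_exp a)].
Proof.
suff [m ->] : exists m, epsilon_exp a = 'X_[m] by rewrite mleadXm.
rewrite /epsilon_exp.
apply: (big_ind (fun p => exists m, p = 'X_[m])).
- by exists 0%MM; rewrite mpolyX0.
- by move=> _ _ [m ->] [m' ->]; exists (m + m')%MM; rewrite mpolyXD.
move=> i _.
suff [m ->] : exists m, epsilon i = 'X_[m].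
  by exists (m *+ a i)%MM; rewrite mpolyXn.
apply: (big_ind (fun p => exists m, p = 'X_[m])).
- by exists 0%MM; rewrite mpolyX0.
- by move=> _ _ [m ->] [m' ->]; exists (m + m')%MM; rewrite mpolyXD.
by move=> A _; exists U_(enum_rank A)%MM.
Qed.

Lemma dvd_monomialP n (m : 'X_{1..n}) (p : {mpoly k[n]}) :
  (exists c, p = c * 'X_[m]) <-> {in msupp p, forall m', (m <= m')%MM}.
Proof.
split=> [[c ->] m' | le_m].
  by move/msuppM_le/allpairsP=> [[u v] /= [_]]; rewrite msuppX inE => /eqP -> ->;
     rewrite lem_addl.
exists (\sum_(m' <- msupp p) p@_m' *: 'X_[m' - m]).
rewrite {1}[p]mpolyE mulr_suml; apply: eq_big_seq => m' /le_m le_mm'.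
by rewrite -scalerAl -mpolyXD submK.
Qed.

Lemma label_lcmP s (p : extremal_ring k q) :
  (exists c, p = c * label s) <->
  {in s, forall a, exists c, p = c * epsilon_exp a}.
Proof.
have lcm_le m' : (\big[@mlcm _/0%MM]_(a <- s) mlead (epsilon_exp a) <= m')%MM
    = all (fun a => mlead (epsilon_exp a) <= m')%MM s.
  elim: (enum_fset s) => [|a l IH]; first by rewrite big_nil; apply/forallP => i; rewrite mnm0E.
  by rewrite big_cons lem_mlcm IH.
have eps_dvd a : (exists c, p = c * epsilon_exp a) <->
    {in msupp p, forall m', (mlead (epsilon_exp a) <= m')%MM}.
  by rewrite {1}epsilon_exp_monomial; apply: dvd_monomialP.
split=> [/dvd_monomialP dvd a sa | dvd].
  by apply/eps_dvd => m' /dvd; rewrite lcm_le => /allP; apply.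
apply/dvd_monomialP => m' pm'; rewrite lcm_le; apply/allP => a sa.
by have /eps_dvd := dvd a sa; apply.
Qed.

End Extremal.

Definition minimal_nonface (T : choiceType) (V : {fset T})
    (face : {fset T} -> Prop) (t : {fset T}) : Prop :=
  [/\ t `<=` V, ~ face t & forall s, s `<` t -> face s].

Inductive nonface_edge (q : nat) : {fset 'X_{1..q}} -> Prop :=
| Edge_aaa_bbb (a b : 'I_q) : uniq [:: a; b] ->
    nonface_edge [fset U_(a) *+ 3; U_(b) *+ 3]%MM
| Edge_aaa_abb (a b : 'I_q) : uniq [:: a; b] ->
    nonface_edge [fset U_(a) *+ 3; U_(a) + U_(b) *+ 2]%MM
| Edge_aaa_bbc (a b c : 'I_q) : uniq [:: a; b; c] ->
    nonface_edge [fset U_(a) *+ 3; U_(b) *+ 2 + U_(c)]%MM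
| Edge_aaa_abc (a b c : 'I_q) : uniq [:: a; b; c] ->
    nonface_edge [fset U_(a) *+ 3; U_(a) + U_(b) + U_(c)]%MM
| Edge_aaa_bcd (a b c d : 'I_q) : uniq [:: a; b; c; d] ->
    nonface_edge [fset U_(a) *+ 3; U_(b) + U_(c) + U_(d)]%MM
| Edge_aab_bbc (a b c : 'I_q) : uniq [:: a; b; c] ->
    nonface_edge [fset U_(a) *+ 2 + U_(b); U_(b) *+ 2 + U_(c)]%MM
| Edge_aab_bcc (a b c : 'I_q) : uniq [:: a; b; c] ->
    nonface_edge [fset U_(a) *+ 2 + U_(b); U_(b) + U_(c) *+ 2]%MM
| Edge_aab_ccd (a b c d : 'I_q) : uniq [:: a; b; c; d] ->
    nonface_edge [fset U_(a) *+ 2 + U_(b); U_(c) *+ 2 + U_(d)]%MM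
| Edge_aab_bcd (a b c d : 'I_q) : uniq [:: a; b; c; d] ->
    nonface_edge [fset U_(a) *+ 2 + U_(b); U_(b) + U_(c) + U_(d)]%MM.

Inductive nonface_triangle (q : nat) : {fset 'X_{1..q}} -> Prop :=
| Triangle_aab_abb_cde (a b c d e : 'I_q) : uniq [:: a; b; c; d; e] ->
    nonface_triangle [fset U_(a) *+ 2 + U_(b); U_(a) + U_(b) *+ 2;
                           U_(c) + U_(d) + U_(e)]%MM.

(* Main.v *)
From Stdlib Require Import Classical_Prop.
Require Import Defs.
From mathcomp Require Import all_boot all_order all_algebra finmap.
From mathcomp Require Import mpoly zify.

Set Implicit Arguments.
Unset Strict Implicit.
Unset Printing Implicit Defensive.

Local Open Scope fset_scope.
Local Open Scope nat_scope.

(** For A a subset of [q] and v an exponent vector, let the weight of v on A be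
    the sum of its coordinates in A.  The exponent of x_A in epsilon^v is exactly
    this weight, so the label of a set s records, for every A, the largest weight
    on A reached in s.  Hence (lemma scarfP) s is a face of the Scarf complex if
    and only if every vertex v, in s or not, is exposed by s: some A gives v a
    strictly larger weight than every other element of s.  Indeed a vertex that is
    not exposed can be put into s or taken out of it without changing the label,
    and conversely a set with the same label as s must agree with s on every
    exposed vertex.

    Degree 3 vectors have one of the shapes aaa, aab, abc (words denote sums of
    unit vectors), and the theorem becomes a comparison of two facts.

    First, every listed set fails to expose some vertex outside it: aab for the
    edges containing aaa, abb for {aab, bbc}, and abc for the other edges and the
    triangle (edge_nonface, triangle_nonface).

    Second, a set s containing no listed set exposes every vertex
    (avoiding_exposed).  The forbidden edges leave little room in s: if aaa lies
    in s then every element of s has the form aax (aaa_in); if aab lies in s then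
    only abb and abc can have weight 2 or more on {b, c} (aab_in); if both aab and
    abb lie in s, which is where the triangles matter, then c occurs only in abc
    (aab_abb_in).  So aaa is exposed by {a}; aab by {b} if aaa is in s, by {a} if
    b is repeated in some element of s, and by {a, b} otherwise; and abc by
    {a, b, c}, unless s contains another vector supported in {a, b, c}, which up to
    permuting the letters is aaa or aab; then {b, c}, or {c} if aab and abb are
    both in s, exposes it.

    Finally no listed set properly contains another: edges have two elements and
    triangles three, and no edge lies in a triangle (edge_not_in_triangle).  So
    proper subsets of listed sets are faces, and the listed sets are exactly the
    minimal nonfaces. *)

(** * Weights and the exposure criterion for faces *)

Definition wt q (A : {set 'I_q}) (v : 'X_{1..q}) : nat := \sum_(i in A) v i.

(** The variable x_A divides epsilon_i once if i is in A and not at all otherwise,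
    which is why exponents are weights. *)
Lemma mlead_epsilon_exp (k : fieldType) q (v : 'X_{1..q}) :
  mlead (epsilon_exp k v) = [multinom wt (val (enum_val j)) v | j < #|{: neset q}|].
Proof.
have epsE i : epsilon k i = 'X_[\sum_(A : neset q | i \in val A) U_(enum_rank A)]%R.
  by rewrite -mprodXE.
rewrite /epsilon_exp; under eq_bigr => i _ do rewrite epsE mpolyXn.
rewrite mprodXE mleadXm; apply/mnmP => j; rewrite mnm_sumE mnmE /wt [RHS]big_mkcond.
apply: eq_bigr => i _; rewrite mulmnE mnm_sumE.
have -> : \sum_(A : neset q | i \in val A) U_(enum_rank A)%MM j
    = (i \in val (enum_val j)).
  rewrite (eq_bigr (fun A => (A == enum_val j) : nat)) => [|A _]; last first.
    by rewrite mnm1E (can2_eq (@enum_rankK _) (@enum_valK _)).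
  rewrite big_mkcond (bigD1 (enum_val j)) //= eqxx big1 => [|A /negPf->];
    last by case: ifP.
  by case: (_ \in _).
by case: (_ \in _); rewrite ?mul1n ?mul0n.
Qed.

Lemma label_eqP (k : fieldType) q (s t : {fset 'X_{1..q}}) :
  label k s = label k t <->
  forall A, \max_(u <- s) wt A u = \max_(u <- t) wt A u.
Proof.
have lcmE l j : (\big[@mlcm _/0%MM]_(a <- l) mlead (epsilon_exp k a))%MM j
    = \max_(u <- l) wt (val (enum_val j)) u.
  elim: l => [|u l IH]; first by rewrite !big_nil mnm0E.
  by rewrite !big_cons -IH mnmE mlead_epsilon_exp mnmE.
split=> [/(congr1 (@mlead _ _)) | eq_max].
  rewrite !mleadXm => eq_lcm A.
  (* There is no variable for the empty A, where all weights vanish. *)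
  have [->|A_n0] := eqVneq A set0.
    by rewrite !big1 // => u _; rewrite /wt big_set0.
  by move/mnmP/(_ (enum_rank (exist _ A A_n0))): eq_lcm; rewrite !lcmE enum_rankK.
by congr ('X_[_]); apply/mnmP => j; rewrite !lcmE.
Qed.

Lemma bigmax_wt_leqP q (A : {set 'I_q}) (s : {fset 'X_{1..q}}) (P : pred 'X_{1..q}) n :
  reflect (forall u, u \in s -> P u -> wt A u <= n)
    (\max_(u <- s | P u) wt A u <= n).
Proof. exact: (@bigmax_leqP_seq _ (enum_fset s)). Qed.

(** The element v itself is left out of the maximum, so that the same condition
    serves for vertices inside and outside s.  Comparing with the maximum rather
    than with each element forces wt A v to be positive even if s has no other
    element. *)
Definition exposed q (s : {fset 'X_{1..q}}) (v : 'X_{1..q}) : bool :=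
  [exists A, \max_(u <- s | u != v) wt A u < wt A v].

Lemma exposedI q (s : {fset 'X_{1..q}}) v A :
  0 < wt A v -> (forall u, u \in s -> u != v -> wt A u < wt A v) -> exposed s v.
Proof.
move=> wt_gt0 lt_wt; apply/existsP; exists A; rewrite -(prednK wt_gt0) ltnS.
by apply/bigmax_wt_leqP => u su u_v; rewrite -ltnS (prednK wt_gt0) lt_wt.
Qed.

(** Faces are the sets exposing all vertices.  If v is not exposed, then s with v
    removed and s with v added have the same label as s, and they differ from each
    other.  If all vertices are exposed, a vertex lying in only one of s and t
    would force some exponent to be larger in that one. *)
Lemma scarfP (k : fieldType) q r (s : {fset 'X_{1..q}}) :
  s `<=` expvecs q r ->
  scarf k r s <-> {in expvecs q r, forall v, exposed s v}.
Proof.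
move=> sV; split=> [[_ scarf_s] v Vv | exp_s].
  apply: contraT => /existsPn dom_v.
  (* Adding or removing v leaves every maximal weight unchanged. *)
  have max_eq t A : s `\ v `<=` t -> t `<=` v |` s ->
      \max_(u <- t) wt A u = \max_(u <- s | u != v) wt A u.
    move=> /fsubsetP st /fsubsetP ts; apply/eqP; rewrite eqn_leq; apply/andP.
    split; apply/bigmax_wt_leqP => u.
      move=> /ts; rewrite in_fset1U; have [-> _ _|u_v /= su _] := eqVneq u v.
        by rewrite leqNgt dom_v.
      by apply: leq_bigmax_seq.
    move=> su u_v; apply: (@leq_bigmax_seq _ (enum_fset t)) => //.
    by apply: st; rewrite in_fsetD1 u_v.
  have leT t : s `\ v `<=` t -> t `<=` v |` s -> t = s.
    move=> st ts; apply/eqP/idPn => ne_ts; apply: (scarf_s t) => [||]; last 1 first.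
    - by apply/label_eqP => A; rewrite !max_eq ?fsubD1set ?fsubsetU1 ?fsubset_refl.
    - by apply: fsubset_trans ts _; rewrite fsubUset fsub1set Vv.
    by apply/eqP.
  have := leT (v |` s); have := leT (s `\ v).
  rewrite fsubset_refl !(fsubset_trans (fsubD1set s v) (fsubsetU1 v s)) => H1 H2.
  have /fsetP/(_ v) := H1 erefl erefl; rewrite -[in RHS](H2 erefl (fsubset_refl _)).
  by rewrite in_fsetD1 in_fset1U eqxx.
split=> // t tV ne_ts /label_eqP eq_st.
have small w (l : {fset 'X_{1..q}}) : w \in expvecs q r -> l `<=` s -> w \notin l ->
    exists A, \max_(u <- l) wt A u < wt A w.
  move=> /exp_s/existsP[A ltA] /fsubsetP ls wl; exists A.
  apply: leq_ltn_trans ltA; apply/bigmax_wt_leqP => u lu _.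
  have /bigmax_wt_leqP := leqnn (\max_(u <- s | u != w) wt A u); apply; first exact: ls.
  by apply: contraNneq wl => <-.
have [/fsubsetP ts | /fsubsetPn[w tw sw]] := boolP (t `<=` s).
  case: ne_ts; apply/eqP; rewrite eqEfsubset; apply/andP; split;
    apply/fsubsetP => // w sw.
  apply: contraT => tw.
  have [||//|A] := small w t; [exact: (fsubsetP sV) | exact/fsubsetP |].
  by rewrite -eq_st ltnNge; have /bigmax_wt_leqP-> := leqnn (\max_(u <- s) wt A u).
have [||//|A] := small w s; [exact: (fsubsetP tV) | exact: fsubset_refl |].
by rewrite eq_st ltnNge; have /bigmax_wt_leqP-> := leqnn (\max_(u <- t) wt A u).
Qed.

(** * Arithmetic of weights and of degree three vectors *)

Lemma wtD q (A : {set 'I_q}) u v : wt A (u + v)%MM = wt A u + wt A v.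
Proof. by rewrite /wt -big_split; apply: eq_bigr => i _; rewrite mnmDE. Qed.

Lemma wtMn q (A : {set 'I_q}) u n : wt A (u *+ n)%MM = wt A u * n.
Proof. by rewrite /wt big_distrl; apply: eq_bigr => i _; rewrite mulmnE. Qed.

Lemma wtU q (A : {set 'I_q}) i : wt A U_(i)%MM = (i \in A).
Proof.
rewrite /wt; case: (boolP (i \in A)) => iA.
  rewrite (bigD1 i) //= mnm1E eqxx big1 // => j /andP[_ /negPf j_i].
  by rewrite mnm1E eq_sym j_i.
by rewrite big1 // => j jA; rewrite mnm1E; case: eqP iA => // ->; rewrite jA.
Qed.

Lemma wt_set1 q (a : 'I_q) v : wt [set a] v = v a.
Proof. exact: big_set1. Qed.

Lemma wt_set2 q (a b : 'I_q) v : a != b -> wt [set a; b] v = v a + v b.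
Proof. by move=> ab; rewrite /wt big_setU1 ?big_set1 // inE. Qed.

Lemma wt_set3 q (a b c : 'I_q) v :
  uniq [:: a; b; c] -> wt [set a; b; c] v = v a + v b + v c.
Proof.
rewrite /= !inE andbT => /andP[abc bc].
by rewrite -setUA /wt big_setU1 ?inE //= big_setU1 ?inE // big_set1 addnA.
Qed.

Lemma leq_wt_mdeg q (A : {set 'I_q}) v : wt A v <= mdeg v.
Proof. by rewrite mdegE /wt big_mkcond; apply: leq_sum => i _; case: ifP. Qed.

(** Turns a uniq hypothesis at the head of the goal into separate disequalities. *)
Ltac split_neqs :=
  rewrite /= ?inE ?negb_or ?andbT;
  let H := fresh "ne" in move=> H;
  repeat match goal with K : is_true (_ && _) |- _ =>
    let K1 := fresh "ne" in let K2 := fresh "ne" in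
    move/andP: K => [K1 K2] end.

Ltac solve_uniq :=
  rewrite /= ?inE ?negb_or ?andbT; repeat (apply/andP; split);
  try done; by rewrite eq_sym.

(** Evaluates coordinates of sums of unit vectors under the disequalities in
    context. *)
Ltac coord :=
  rewrite ?(mnmDE, mulmnE, mnm1E) ?eqxx;
  repeat match goal with
  | H : is_true (?x != ?y) |- context [?x == ?y] => rewrite (negPf H)
  | H : is_true (?x != ?y) |- context [?y == ?x] => rewrite (eq_sym y x) (negPf H)
  end.

(** Equality of two sums of unit vectors is linear in the indicators a == i; the
    context is cleared because it only slows the linear arithmetic down. *)
Ltac mnm_eq := apply/mnmP => ?; rewrite ?(mnmDE, mulmnE, mnm1E); clear; lia.

(** The three goals left are distinctness of the letters and the two equations
    that put the vectors at hand in the normal form of the constructor E. *)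
Ltac by_edge edge E :=
  apply: (edge _ _ (E _)); [solve_uniq | mnm_eq | mnm_eq].

(** Two coordinates suffice to tell apart all the vectors compared below. *)
Ltac mnm_neq a b :=
  let eq_uv := fresh "eq_uv" in
  apply/eqP => /mnmP eq_uv; move: (eq_uv a) (eq_uv b); coord; clear; lia.

(** The weight comparison holds for all A because it holds for all truth values
    of the memberships of the letters in A. *)
Ltac dominate H v a b :=
  apply: (H _ _ v);
  [ by rewrite ?(mdegD, mdegMn, mdeg1) | mnm_neq a b | mnm_neq a b
   | by move=> A; rewrite !(wtD, wtMn, wtU); clear; lia ].

Lemma mnm_le_split q n (m w : 'X_{1..q}) :
  mdeg w = n -> (forall i, m i <= w i) ->
  exists2 w', w = (m + w')%MM & mdeg w' = n - mdeg m.
Proof.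
move=> <- le_mw; have m_w : (m <= w)%MM by apply/mnm_lepP.
exists (w - m)%MM; first by rewrite addmC submK.
by rewrite -{2}(submK m_w) mdegD addnK.
Qed.

Lemma mdeg1_ex q (w : 'X_{1..q}) : mdeg w = 1 -> exists x, w = U_(x)%MM.
Proof. by move/eqP/mdeg1P => [x /eqP->]; exists x. Qed.

Lemma mdeg_gt0_ex q (w : 'X_{1..q}) n :
  mdeg w = n.+1 -> exists x, 0 < w x.
Proof.
move=> dw; have [/mnmP w0|] := eqVneq w 0%MM.
  by move: dw; rewrite mdegE big1 // => i _; rewrite w0 mnm0E.
move=> /eqP w_n0; apply/existsP; apply: contraT => /existsPn w0; case: w_n0.
by apply/mnmP => i; have := w0 i; rewrite mnm0E; lia.
Qed.

Section DegreeThree.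
Variables (q : nat) (w : 'X_{1..q}).
Hypothesis w3 : mdeg w = 3.

Lemma deg3_ge1 a : 0 < w a -> exists x y, w = (U_(a) + U_(x) + U_(y))%MM.
Proof.
move=> wa; have [|w' ->] := @mnm_le_split _ _ U_(a)%MM _ w3.
  by move=> i; rewrite mnm1E; case: eqP => [<-|].
rewrite mdeg1 => w2; have [x w'x] := mdeg_gt0_ex w2.
have [|w'' ->] := @mnm_le_split _ _ U_(x)%MM _ w2.
  by move=> i; rewrite mnm1E; case: eqP => [<-|].
by rewrite mdeg1 => /mdeg1_ex[y ->]; exists x, y; rewrite addmA.
Qed.

Lemma deg3_ex : exists x y z, w = (U_(x) + U_(y) + U_(z))%MM.
Proof. by have [x /deg3_ge1] := mdeg_gt0_ex w3; exists x. Qed.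

Lemma deg3_ge2 a : 1 < w a -> exists x, w = (U_(a) *+ 2 + U_(x))%MM.
Proof.
move=> wa; have [|w' ->] := @mnm_le_split _ _ (U_(a) *+ 2)%MM _ w3.
  by move=> i; rewrite mulmnE mnm1E; case: eqP => [<-|].
by rewrite mdegMn mdeg1 => /mdeg1_ex[x ->]; exists x.
Qed.

Lemma deg3_ge3 a : 2 < w a -> w = (U_(a) *+ 3)%MM.
Proof.
move=> wa; have [x wE] := deg3_ge2 (ltnW wa); rewrite wE.
move: wa; rewrite wE; coord; case: (eqVneq x a) => [->|]; last by lia.
by move=> _; mnm_eq.
Qed.

Lemma deg3_ge11 a b : a != b -> 0 < w a -> 0 < w b ->
  exists x, w = (U_(a) + U_(b) + U_(x))%MM.
Proof.
move=> ab wa wb; have [|w' ->] := @mnm_le_split _ _ (U_(a) + U_(b))%MM _ w3.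
  move=> i; rewrite mnmDE !mnm1E; case: (eqVneq a i) => [<-|_];
    last by case: eqP => [<-|].
  by rewrite eq_sym (negPf ab).
by rewrite mdegD !mdeg1 => /mdeg1_ex[x ->]; exists x.
Qed.

End DegreeThree.

(** * Sets without listed subsets *)

Definition avoiding q (s : {fset 'X_{1..q}}) :=
  forall t, nonface_edge t \/ nonface_triangle t -> ~ t `<=` s.

Section Avoiding.
Variables (q : nat) (s : {fset 'X_{1..q}}).
Hypotheses (sV : s `<=` expvecs q 3) (s_av : avoiding s).

Lemma deg3 w : w \in s -> mdeg w = 3.
Proof. by move/(fsubsetP sV); rewrite in_expvecs => /eqP. Qed.

(** The equations let u and w be given in any order of their summands. *)
Lemma avoid_edge u w u' w' :
  u \in s -> w \in s -> nonface_edge [fset u'; w'] -> u = u' -> w = w' -> False.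
Proof.
move=> su sw edge uE wE; apply: (s_av (or_introl edge)).
by rewrite -uE -wE fsubUset !fsub1set su sw.
Qed.

(** Every degree 3 vector in which a occurs at most once forms a listed edge with
    aaa. *)
Lemma aaa_in w a : (U_(a) *+ 3)%MM \in s -> w \in s -> 1 < w a.
Proof.
move=> sa sw; have edge := avoid_edge sa sw; rewrite ltnNge; apply/negP => wa.
have w3 := deg3 sw; have [wa0|wa_gt0] := posnP (w a).
  have [x [y [z wE]]] := deg3_ex w3; subst w.
  move: wa0; coord => /eqP; rewrite !addn_eq0 !eqb0.
  move=> nes; have {nes} : [&& x != a, y != a & z != a] by rewrite andbA.
  split_neqs.
  have [?|xy] := eqVneq x y; first subst y.
    have [?|xz] := eqVneq x z; first subst z.
      by by_edge edge (@Edge_aaa_bbb q a x).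
    by by_edge edge (@Edge_aaa_bbc q a x z).
  have [?|xz] := eqVneq x z; first subst z.
    by by_edge edge (@Edge_aaa_bbc q a x y).
  have [?|yz] := eqVneq y z; first subst z.
    by by_edge edge (@Edge_aaa_bbc q a y x).
  by by_edge edge (@Edge_aaa_bcd q a x y z).
have [x [y wE]] := deg3_ge1 w3 wa_gt0; subst w.
have {wa} : [&& x != a & y != a].
  by move: wa; coord; do 2!case: eqP.
split_neqs; have [?|xy] := eqVneq x y; first subst y.
  by by_edge edge (@Edge_aaa_abb q a x).
by by_edge edge (@Edge_aaa_abc q a x y).
Qed.

(** All other vectors of weight at least 2 on {b, c} form a listed edge with aab:
    bbx and ccx always, bcx unless x is a. *)
Lemma aab_in w a b c : uniq [:: a; b; c] ->
  (U_(a) *+ 2 + U_(b))%MM \in s -> w \in s -> 1 < w b + w c ->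
  w = (U_(a) + U_(b) *+ 2)%MM \/ w = (U_(a) + U_(b) + U_(c))%MM.
Proof.
split_neqs => sab sw w_bc; have edge := avoid_edge sab sw.
have wedge := avoid_edge sw sab.
have w3 := deg3 sw.
have [wb2|wb2] := ltnP 1 (w b).
  have [x wE] := deg3_ge2 w3 wb2; subst w.
  have [?|xa] := eqVneq x a; first by subst x; left; mnm_eq.
  exfalso; have [?|xb] := eqVneq x b; first subst x.
    by by_edge wedge (@Edge_aaa_abb q b a).
  by by_edge edge (@Edge_aab_bbc q a b x).
have [wb0|wb1] := posnP (w b).
  rewrite wb0 add0n in w_bc; have [x wE] := deg3_ge2 w3 w_bc; subst w.
  exfalso; have [?|xa] := eqVneq x a; first subst x.
    by by_edge wedge (@Edge_aab_bbc q c a b).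
  have [?|xc] := eqVneq x c; first subst x.
    by by_edge wedge (@Edge_aaa_bbc q c a b).
  have xb : x != b by apply: contraTneq isT => xb; move: wb0; rewrite xb; coord.
  by by_edge edge (@Edge_aab_ccd q a b c x).
have wc : 0 < w c by lia.
have [//|x wE] := @deg3_ge11 _ _ w3 b c _ wb1 wc; subst w.
have [?|xa] := eqVneq x a; first by subst x; right; mnm_eq.
exfalso; have [?|xc] := eqVneq x c; first subst x.
  by by_edge edge (@Edge_aab_bcc q a b c).
have xb : x != b by apply: contraTneq wb2 => ->; coord.
by by_edge edge (@Edge_aab_bcd q a b c x).
Qed.

(** If w contains a or b besides c, the edges at aab and abb force w to be abc.
    Otherwise w is disjoint from {a, b}: it forms an edge with aab if a letter is
    repeated, and a triangle with aab and abb if not. *)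
Lemma aab_abb_in w a b c : uniq [:: a; b; c] ->
  (U_(a) *+ 2 + U_(b))%MM \in s -> (U_(a) + U_(b) *+ 2)%MM \in s ->
  w \in s -> 0 < w c -> w = (U_(a) + U_(b) + U_(c))%MM.
Proof.
move=> abc.
wlog wa : a b abc / w b <= w a => [wlog_ab|].
  have [le_ba|/ltnW le_ab] := leqP (w b) (w a); first exact: (wlog_ab a b).
  move=> saab sabb sw wc; rewrite [X in (X + _)%MM]addmC.
  by apply: wlog_ab; rewrite // ?[(U_(b) + _)%MM]addmC 1?[(_ + U_(a))%MM]addmC //;
    move: abc; split_neqs; solve_uniq.
move: abc; split_neqs => saab sabb sw wc.
have w3 := deg3 sw.
have edge := avoid_edge saab sw; have wedge := avoid_edge sw saab.
have edgeb := avoid_edge sabb sw.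
have [wa0|wa_gt0] := posnP (w a).
  have wb0 : w b = 0 by lia.
  exfalso; have [x [y wE]] := deg3_ge1 w3 wc; subst w.
  have xy : [&& x != a, x != b, y != a & y != b].
    rewrite -!eqb0; move: wa0 wb0; coord => /eqP.
    by rewrite addn_eq0 => /andP[-> ->] /eqP; rewrite addn_eq0 => /andP[-> ->].
  move: xy; split_neqs.
  have [?|xc] := eqVneq x c; first subst x.
    have [?|yc] := eqVneq y c; first subst y.
      by by_edge wedge (@Edge_aaa_bbc q c a b).
    by by_edge edge (@Edge_aab_ccd q a b c y).
  have [?|yc] := eqVneq y c; first subst y.
    by by_edge edge (@Edge_aab_ccd q a b c x).
  have [?|yx] := eqVneq y x; first subst y.
    by by_edge edge (@Edge_aab_ccd q a b x c).
  apply: (s_av (or_intror (@Triangle_aab_abb_cde q a b c x y _))).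
    by solve_uniq.
  by rewrite !fsubUset !fsub1set saab sabb sw.
have [//|x wE] := @deg3_ge11 _ _ w3 a c _ wa_gt0 wc; subst w.
have [?|xb] := eqVneq x b; first by subst x; mnm_eq.
exfalso; have [?|xa] := eqVneq x a; first subst x.
  by by_edge edgeb (@Edge_aab_bbc q b a c).
have [?|xc] := eqVneq x c; first subst x.
  by by_edge wedge (@Edge_aab_bbc q c a b).
by by_edge edgeb (@Edge_aab_bcd q b a c x).
Qed.

Lemma mulm3 (m : 'X_{1..q}) : (m *+ 3 = m *+ 2 + m)%MM.
Proof. by mnm_eq. Qed.

(** * A set without listed subsets exposes every vertex *)

Lemma exposed_aaa a : exposed s (U_(a) *+ 3)%MM.
Proof.
apply: (@exposedI _ _ _ [set a]); rewrite wt_set1; coord => // u su u_aaa.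
rewrite wt_set1 ltnNge; apply: contra u_aaa => ua.
by apply/eqP/deg3_ge3 => //; exact: deg3.
Qed.

(** The exposing set is {b} if aaa is in s, since then every element of s is some
    aax; it is {a} if b is repeated in some element of s, which rules out any
    aax with x other than b; and {a, b} otherwise. *)
Lemma exposed_aab a b : a != b -> exposed s (U_(a) *+ 2 + U_(b))%MM.
Proof.
move=> ab; have [saaa|naaa] := boolP ((U_(a) *+ 3)%MM \in s).
  apply: (@exposedI _ _ _ [set b]); rewrite wt_set1; coord => // u su u_aab.
  rewrite wt_set1 ltnNge; apply: contra u_aab => ub; apply/eqP.
  have [x uE] := deg3_ge2 (deg3 su) (aaa_in saaa su); subst u.
  move: ub; coord; case: (eqVneq x b) => [-> //|]; by [].
have [sb|nb] := boolP (has (fun u : 'X_{1..q} => 1 < u b) s).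
  (* An aax in s with x different from b would form an edge with the element u. *)
  have [u su ub] := hasP sb.
  apply: (@exposedI _ _ _ [set a]); rewrite wt_set1; coord => // w sw w_aab.
  rewrite wt_set1 ltnNge; apply/negP => wa.
  have [x wE] := deg3_ge2 (deg3 sw) wa; subst w.
  have [?|xa] := eqVneq x a; first by subst x; case/negP: naaa; rewrite mulm3.
  have xb : x != b by apply: contraNneq w_aab => ->.
  have [||uE|uE] := @aab_in u a x b _ sw su _.
  - by solve_uniq.
  - exact: leq_trans ub (leq_addl _ _).
  - by move: ub; rewrite uE; coord.
  by move: ub; rewrite uE; coord.
apply: (@exposedI _ _ _ [set a; b]); rewrite wt_set2 //; coord => // u su u_aab.
rewrite wt_set2 // ltnNge; apply: contra nb => uab; apply/hasP; exists u => //.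
rewrite ltnNge; apply: contra u_aab => ub; apply/eqP.
have [|x uE] := @deg3_ge2 _ _ (deg3 su) a; first by lia.
subst u; have [-> //|xb] := eqVneq x b.
have [?|xa] := eqVneq x a; last by move: uab; coord.
by subst x; case/negP: naaa; rewrite mulm3.
Qed.

(** The presence of aaa or aab leaves nothing but abc and possibly abb with
    weight 2 on {b, c}; if abb is there, c occurs in abc only. *)
Lemma exposed_abc_of_aax v a b c x : uniq [:: a; b; c] ->
  v = (U_(a) + U_(b) + U_(c))%MM -> (x == a) || (x == b) ->
  (U_(a) *+ 2 + U_(x))%MM \in s -> exposed s v.
Proof.
move=> abc -> /orP[]/eqP-> su; move: abc; split_neqs.
  have saaa : (U_(a) *+ 3)%MM \in s.
    by rewrite mulm3.
  apply: (@exposedI _ _ _ [set b; c]); rewrite wt_set2 //; coord => // w sw _.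
  have := leq_wt_mdeg [set a; b; c] w; rewrite wt_set3 ?wt_set2 ?(deg3 sw) //;
    last by solve_uniq.
  by have := aaa_in saaa sw; lia.
have [sabb|nabb] := boolP ((U_(a) + U_(b) *+ 2)%MM \in s).
  apply: (@exposedI _ _ _ [set c]); rewrite wt_set1; coord => // w sw w_abc.
  rewrite wt_set1 ltnNge; apply: contra w_abc => wc; apply/eqP.
  by apply: (aab_abb_in _ su sabb sw wc); solve_uniq.
apply: (@exposedI _ _ _ [set b; c]); rewrite wt_set2 //; coord => // w sw w_abc.
rewrite wt_set2 // ltnNge; apply: contra w_abc => wbc; apply/eqP.
have [||wE|//] := @aab_in w a b c _ su sw _; [by solve_uniq | by [] |].
by case/negP: nabb; rewrite -wE.
Qed.

(** Unless {a, b, c} itself exposes abc, s has another element u supported in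
    {a, b, c}; some letter is repeated in u, and renaming makes it the first one. *)
Lemma exposed_abc v a b c :
  uniq [:: a; b; c] -> v = (U_(a) + U_(b) + U_(c))%MM -> exposed s v.
Proof.
move=> abc vE.
have [/hasP[u su /andP[u_v u_sum]]|/hasPn small] := boolP
    (has (fun u : 'X_{1..q} => (u != v) && (2 < u a + u b + u c)) s); last first.
  have wt_v : wt [set a; b; c] v = 3.
    by rewrite wt_set3 // vE; move: abc; split_neqs; coord.
  apply: (@exposedI _ _ _ [set a; b; c]); rewrite wt_v // => u su u_v.
  by rewrite wt_set3 //; have := small u su; rewrite u_v; lia.
have u3 := deg3 su.
have key x y z : uniq [:: x; y; z] -> v = (U_(x) + U_(y) + U_(z))%MM ->
    2 < u x + u y + u z -> 1 < u x -> exposed s v.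
  move=> xyz v_xyz sum_xyz ux; have [t uE] := deg3_ge2 u3 ux.
  subst u; have [txy|] := boolP ((t == x) || (t == y)).
    exact: exposed_abc_of_aax v_xyz txy su.
  split_neqs; move: xyz; split_neqs.
  have [?|tz] := eqVneq t z; last by move: sum_xyz; coord.
  subst t; apply: (@exposed_abc_of_aax v x z y) su; last by rewrite eqxx orbT.
    by solve_uniq.
  by rewrite v_xyz; mnm_eq.
move: (abc); split_neqs.
have [ua|ua] := ltnP 1 (u a); first by apply: key u_sum ua.
have [ub|ub] := ltnP 1 (u b).
  apply: (key b a c) => //; [by solve_uniq | by rewrite vE; mnm_eq | by lia].
have [uc|uc] := ltnP 1 (u c).
  apply: (key c a b) => //; [by solve_uniq | by rewrite vE; mnm_eq | by lia].
have ua1 : 0 < u a by lia.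
have ub1 : 0 < u b by lia.
have [//|x uE] := @deg3_ge11 _ _ u3 a b _ ua1 ub1.
(* No letter is repeated in u, so u would be abc. *)
have xc : x = c.
  apply/eqP; move: u_sum ua ub uc; rewrite uE; coord.
  by case: eqVneq => //= _; case: eqVneq => //= _; case: eqVneq.
by case/eqP: u_v; rewrite uE vE xc.
Qed.

Lemma avoiding_exposed v : v \in expvecs q 3 -> exposed s v.
Proof.
rewrite in_expvecs => /eqP v3; have [x [y [z ->]]] := deg3_ex v3.
have aab a b : exposed s (U_(a) *+ 2 + U_(b))%MM.
  have [->|ab] := eqVneq a b; last exact: exposed_aab.
  by rewrite -mulm3; exact: exposed_aaa.
have [<-|xy] := eqVneq x y; first exact: aab.
have [<-|xz] := eqVneq x z.
  by rewrite (_ : _ + _ = U_(x) *+ 2 + U_(y))%MM; [exact: aab | mnm_eq].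
have [<-|yz] := eqVneq y z.
  by rewrite (_ : _ + _ = U_(y) *+ 2 + U_(x))%MM; [exact: aab | mnm_eq].
by apply: exposed_abc erefl; solve_uniq.
Qed.

End Avoiding.

(** * Listed sets are nonfaces *)

Lemma dominated_nonface (k : fieldType) q r (s : {fset 'X_{1..q}}) v :
  s `<=` expvecs q r -> mdeg v = r -> v \notin s ->
  (forall A, exists2 u, u \in s & wt A v <= wt A u) -> ~ scarf k r s.
Proof.
move=> sV v3 sv dom /(scarfP _ sV)/(_ v); rewrite in_expvecs v3 eqxx => /(_ isT).
case/existsP => A; have [u su le_vu] := dom A.
rewrite ltnNge (leq_trans le_vu) //.
apply: (@leq_bigmax_seq _ (enum_fset s) (fun u => u != v)) => //.
by apply: contraNneq sv => <-.
Qed.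

(** The vertex that is not exposed is aab for the five edges at aaa, abb for
    {aab, bbc} and abc for the other three: whatever the set A, the vector of the
    edge that carries more of A carries at least as much as this vertex. *)
Lemma edge_nonface (k : fieldType) q (t : {fset 'X_{1..q}}) :
  t `<=` expvecs q 3 -> nonface_edge t -> ~ scarf k 3 t.
Proof.
have by_dominated (u w v : 'X_{1..q}) : mdeg v = 3 -> v != u -> v != w ->
    (forall A, wt A v <= wt A u \/ wt A v <= wt A w) ->
    [fset u; w] `<=` expvecs q 3 -> ~ scarf k 3 [fset u; w].
  move=> v3 vu vw dom tV; apply: (dominated_nonface tV v3).
    by rewrite in_fset2 negb_or vu.
  move=> A; case: (dom A); first by exists u; rewrite ?fset21.
  by exists w; rewrite ?fset22.
move=> tV edge;
  case: edge tV => [a b|a b|a b c|a b c|a b c d|a b c|a b c|a b c d|a b c d];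
  split_neqs.
- dominate by_dominated (U_(a) *+ 2 + U_(b))%MM a b.
- dominate by_dominated (U_(a) *+ 2 + U_(b))%MM a b.
- dominate by_dominated (U_(a) *+ 2 + U_(b))%MM a b.
- dominate by_dominated (U_(a) *+ 2 + U_(b))%MM a b.
- dominate by_dominated (U_(a) *+ 2 + U_(b))%MM a b.
- dominate by_dominated (U_(a) + U_(b) *+ 2)%MM a b.
- dominate by_dominated (U_(a) + U_(b) + U_(c))%MM a b.
- dominate by_dominated (U_(a) + U_(b) + U_(c))%MM a b.
- dominate by_dominated (U_(a) + U_(b) + U_(c))%MM a b.
Qed.

Lemma triangle_nonface (k : fieldType) q (t : {fset 'X_{1..q}}) :
  t `<=` expvecs q 3 -> nonface_triangle t -> ~ scarf k 3 t.
Proof.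
move=> + tri; case: tri => a b c d e; split_neqs => tV.
apply: (dominated_nonface tV (v := (U_(a) + U_(b) + U_(c))%MM)).
- by rewrite !mdegD !mdeg1.
- by rewrite !inE !negb_or -andbA; apply/and3P; split; mnm_neq a b.
move=> A; have [|[]] :
  wt A (U_(a) + U_(b) + U_(c))%MM <= wt A (U_(a) *+ 2 + U_(b))%MM \/
  wt A (U_(a) + U_(b) + U_(c))%MM <= wt A (U_(a) + U_(b) *+ 2)%MM \/
  wt A (U_(a) + U_(b) + U_(c))%MM <= wt A (U_(c) + U_(d) + U_(e))%MM.
- by rewrite !(wtD, wtMn, wtU); clear; lia.
- by exists (U_(a) *+ 2 + U_(b))%MM; rewrite // !inE eqxx.
- by exists (U_(a) + U_(b) *+ 2)%MM; rewrite // !inE eqxx orbT.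
by exists (U_(c) + U_(d) + U_(e))%MM; rewrite // !inE eqxx orbT.
Qed.

(** * Listed sets form an antichain *)

Lemma card_edge q (t : {fset 'X_{1..q}}) : nonface_edge t -> #|` t| = 2.
Proof.
case=> [a b|a b|a b c|a b c|a b c d|a b c|a b c|a b c d|a b c d]; split_neqs;
  apply/eqP; rewrite cardfs2 eqSS eqb1; mnm_neq a b.
Qed.

Lemma card_triangle q (t : {fset 'X_{1..q}}) : nonface_triangle t -> #|` t| = 3.
Proof.
have card3 (u v w : 'X_{1..q}) :
    u != v -> w != u -> w != v -> #|` [fset u; v; w]| = 3.
  by move=> uv wu wv; rewrite fsetUC cardfsU1 cardfs2 in_fset2 negb_or uv wu wv.
by case=> a b c d e; split_neqs; apply: card3; mnm_neq a b.
Qed.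

(** Properties of pairs in a triangle that separate triangles from edges: no letter
    occurs three times, and if u has a repeated letter missing from w, then w is
    the squarefree element and shares no letter with u. *)
Lemma triangle_pair q (t : {fset 'X_{1..q}}) u w i : nonface_triangle t ->
  u \in t -> w \in t ->
  u i <= 2 /\
  (u i = 2 -> w i = 0 -> forall j, w j <= 1 /\ (u j = 0 \/ w j = 0)).
Proof.
case=> a b c d e abcde; rewrite !inE.
have once j : (a == j) + (b == j) + (c == j) + (d == j) + (e == j) <= 1.
  have := count_uniq_mem j abcde; rewrite /= addn0 !addnA => ->.
  by case: (_ \in _).
have oi := once i.
move=> /orP[/orP[]|]/eqP-> /orP[/orP[]|]/eqP->; rewrite ?(mnmDE, mulmnE, mnm1E).
all: split=> [|ui wi j]; first by move: oi; clear; lia.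
all: move: oi ui wi (once j); rewrite ?(mnmDE, mulmnE, mnm1E); clear; lia.
Qed.

(** In an edge the first letter a is cubed in one vector, or it is squared in one
    and absent from the other; in the latter case the other vector repeats a letter
    or shares b. *)
Lemma edge_not_in_triangle q (s t : {fset 'X_{1..q}}) :
  nonface_edge s -> nonface_triangle t -> ~ s `<=` t.
Proof.
move=> edge tri;
  case: edge => [a b|a b|a b c|a b c|a b c d|a b c|a b c|a b c d|a b c d];
  split_neqs; rewrite fsubUset !fsub1set => /andP[ut wt];
  have [ua le1] := triangle_pair a tri ut wt; move: ua le1;
  coord => // _ /(_ erefl erefl).
- by case/(_ b); coord.
- by case/(_ c); coord.
- by case/(_ c); coord.
- by case/(_ b); coord => _ [].
Qed.

(** * Classification of the minimal nonfaces *)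

Theorem theorem5p5 (k : fieldType) (q : nat) (q_ge1 : (1 <= q)%N)
    (tau : {fset 'X_{1..q}}) (tau_vertices : fsubset tau (expvecs q 3))
    (tau_nonempty : tau <> fset0) :
  minimal_nonface (expvecs q 3) (scarf k 3) tau <->
  nonface_edge tau \/ nonface_triangle tau.
Proof.
have nonfaceP s : s `<=` expvecs q 3 ->
    nonface_edge s \/ nonface_triangle s -> ~ scarf k 3 s.
  by move=> sV []; [exact: edge_nonface | exact: triangle_nonface].
have faceP s : s `<=` expvecs q 3 -> avoiding s -> scarf k 3 s.
  by move=> sV s_av; apply/scarfP => // v; apply: avoiding_exposed.
split=> [[_ tau_nonface tau_min] | listed].
  apply: NNPP => unlisted; apply: tau_nonface; apply: faceP => // t t_listed t_tau.
  have [t_eq|t_neq] := eqVneq t tau; first by apply: unlisted; rewrite -t_eq.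
  apply: (nonfaceP t) => //; first exact: fsubset_trans tau_vertices.
  by apply: tau_min; rewrite fproperEneq t_neq.
split=> // [|s s_tau]; first exact: nonfaceP.
have sub_s_tau := fproper_sub s_tau; have card_s := fproper_ltn_card s_tau.
apply: faceP => [|t t_listed t_s]; first exact: fsubset_trans tau_vertices.
have := leq_ltn_trans (fsubset_leq_card t_s) card_s.
case: listed t_listed => [e_tau|t_tau] [e_t|t_t]; rewrite ?(card_edge e_tau)
  ?(card_triangle t_tau) ?(card_edge e_t) ?(card_triangle t_t) // => _.
exact: edge_not_in_triangle e_t t_tau (fsubset_trans t_s sub_s_tau).
Qed.
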